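(* Let $n\ge1$ and $0<q,\theta<\infty$. Assume that $u,w\in\mathcal W(0,\infty)$ and $v\in\mathcal W(\mathbb R^n)$. Then the following two statements are equivalent. (i) There exists a constant $C$ such that $$\bigg(\int_0^\infty\bigg(\int_{B(0,t)}f(s)v(s)\,ds\bigg)^{q}u(t)\,dt\bigg)^{\frac1q}\le C\bigg(\int_0^\infty\bigg(\int_{B(0,t)}f(s)\,ds\bigg)^{\theta}w(t)\,dt\bigg)^{\frac1\theta}$$ holds for every $f\in\mathcal M^+(\mathbb R^n)$. (ii) There exists a constant $C'$ such that $$\bigg(\int_0^\infty\bigg(\int_0^t g(s)\tilde v(s)\,ds\bigg)^{q}u(t)\,dt\bigg)^{\frac1q}\le C'\bigg(\int_0^\infty\bigg(\int_0^t g(s)\,ds\bigg)^{\theta}w(t)\,dt\bigg)^{\frac1\theta}$$ holds for every $g\in\mathcal M^+(0,\infty)$, where $$\tilde v(t):=\operatorname*{ess\,sup}_{s'\in S^{n-1}}v(ts').$$ Moreover, the best (smallest) constants $C$ and $C'$ in these two inequalities satisfy $C\approx C'$.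
   Context: For a nonempty measurable set $A\subset\mathbb R^n$, $\mathcal M^+(A)$ denotes the set of nonnegative measurable functions on $A$, and $\mathcal W(A)$ the set of weights on $A$, i.e. measurable functions on $A$ that are positive and finite a.e.; for $A=(0,\infty)$ one writes $\mathcal M^+(0,\infty)$, $\mathcal W(0,\infty)$. $B(0,t)$ is the open ball in $\mathbb R^n$ centred at $0$ of radius $t$. $S^{n-1}=\{x\in\mathbb R^n:|x|=1\}$ is the unit sphere and $\sigma$ is the unique Borel measure on it such that $\int_{\mathbb R^n}f(x)\,dx=\int_0^\infty\int_{S^{n-1}}f(\tau x')\tau^{n-1}\,d\sigma(x')\,d\tau$ for every nonnegative Borel function $f$ on $\mathbb R^n$; the essential supremum over $S^{n-1}$ is with respect to $\sigma$. $A\approx B$ means $\lambda^{-1}B\le A\le\lambda B$ for some constant $\lambda>0$ depending only on inessential parameters (at most on $n,q,\theta$, and not on the weights $u,v,w$). *)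

(* Defs.v *)
From HB Require Import structures.
From mathcomp Require Import all_boot all_order all_algebra.
From mathcomp Require Import all_classical all_reals all_analysis.
From mathcomp Require Import measurable_realfun ess_sup_inf.

Set Implicit Arguments.
Unset Strict Implicit.
Unset Printing Implicit Defensive.

Import Order.TTheory GRing.Theory Num.Theory.
Import numFieldNormedType.Exports.

Local Open Scope classical_set_scope.
Local Open Scope ring_scope.
Local Open Scope ereal_scope.

(* R^n is [n.-tuple R] with its product sigma-algebra, which is the Borel
   sigma-algebra of R^n. *)
Definition scalet (R : realType) (n : nat) (a : R) (x : n.-tuple R) :
  n.-tuple R := [tuple (a * tnth x i)%R | i < n].

Definition enorm (R : realType) (n : nat) (x : n.-tuple R) : R :=
  Num.sqrt (\sum_(i < n) tnth x i ^+ 2)%R.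

Definition eball (R : realType) (n : nat) (r : R) : set (n.-tuple R) :=
  [set x | (enorm x < r)%R].

Definition sphere (R : realType) (n : nat) : set (n.-tuple R) :=
  [set x | enorm x = 1%R].

Arguments eball {R} n r _.
Arguments sphere {R} n _.

Section lebesgue_measure_Rn.
Context {R : realType}.

Definition tcons (n : nat) (p : measurableTypeR R * n.-tuple R) :
  n.+1.-tuple R := [tuple of p.1 :: p.2].

Lemma measurable_tcons (n : nat) : measurable_fun setT (@tcons n).
Proof. exact: measurable_cons. Qed.

Definition lebesgue0 : set (0.-tuple R) -> \bar R := \d_([tuple] : 0.-tuple R).

HB.instance Definition _ := Measure.on lebesgue0.

Let lebesgue0_sigma_finite : sigma_finite setT lebesgue0.
Proof.
exists (fun=> setT); first by rewrite bigcup_const.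
by move=> _; split => //=; rewrite /lebesgue0 diracT ltry.
Qed.

HB.instance Definition _ :=
  Measure_isSigmaFinite.Build _ _ _ lebesgue0 lebesgue0_sigma_finite.

Section step.
Variables (n : nat) (mu : {sigma_finite_measure set (n.-tuple R) -> \bar R}).

Definition lebesgueS : set (n.+1.-tuple R) -> \bar R :=
  pushforward (@lebesgue_measure R \x mu) (@tcons n).

Let lebesgueS0 : lebesgueS set0 = 0.
Proof. by rewrite /lebesgueS /pushforward preimage_set0 measure0. Qed.

Let lebesgueS_ge0 A : 0 <= lebesgueS A.
Proof. exact: (measure_ge0 (@lebesgue_measure R \x mu)). Qed.

Let lebesgueS_sigma_additive : semi_sigma_additive lebesgueS.
Proof.
move=> F mF tF mUF; rewrite /lebesgueS /pushforward preimage_bigcup.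
have mpre A : measurable A -> measurable (@tcons n @^-1` A).
  by move=> mA; rewrite -[X in measurable X]setTI; exact: measurable_tcons.
apply: measure_semi_sigma_additive.
- by move=> k; exact: mpre.
- by move=> i j Di Dj [p [/= Fip Fjp]]; apply: (tF i j Di Dj); exists (tcons p).
- by rewrite -preimage_bigcup; exact: mpre.
Qed.

HB.instance Definition _ := isMeasure.Build _ _ _ lebesgueS
  lebesgueS0 lebesgueS_ge0 lebesgueS_sigma_additive.

Let lebesgueS_sigma_finite : sigma_finite setT lebesgueS.
Proof.
pose split (x : n.+1.-tuple R) : measurableTypeR R * n.-tuple R :=
  (tnth x ord0, [tuple of behead x]).
have splitK p : split (tcons p) = p.
  by case: p => a t; congr pair; exact/val_inj.
have msplit : measurable_fun setT split.
  by apply/measurable_fun_pair => /=;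
    [exact: measurable_tnth|exact: measurable_behead].
have /sigma_finiteP[F [FT ndF Foo]] := sigma_finiteT (@lebesgue_measure R).
have /sigma_finiteP[G [GT ndG Goo]] := sigma_finiteT mu.
exists (fun k => split @^-1` (F k `*` G k)).
  apply/esym/seteqP; split => // x _.
  have [i _ Fi] : (\bigcup_i F i) (split x).1 by rewrite -FT.
  have [j _ Gj] : (\bigcup_j G j) (split x).2 by rewrite -GT.
  exists (maxn i j) => //; split.
    by move: Fi; exact/subsetPset/ndF/leq_maxl.
  by move: Gj; exact/subsetPset/ndG/leq_maxr.
move=> k; have [mF Fk] := Foo k; have [mG Gk] := Goo k; split.
  rewrite -[X in measurable X]setTI; apply: msplit => //.
  exact: measurableX.
rewrite /lebesgueS /pushforward -comp_preimage.
rewrite (_ : split \o _ = idfun); last exact/funext.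
by rewrite preimage_id product_measure1E// lte_mul_pinfty// ge0_fin_numE.
Qed.

HB.instance Definition _ :=
  Measure_isSigmaFinite.Build _ _ _ lebesgueS lebesgueS_sigma_finite.

End step.

(* Lebesgue measure on the Borel sets of R^n, as an n-fold product. *)
Fixpoint borel_lebesgue (n : nat) :
    {sigma_finite_measure set (n.-tuple R) -> \bar R} :=
  match n with
  | 0%N => lebesgue0
  | m.+1 => lebesgueS (borel_lebesgue m)
  end.

(* Its completion, on the Lebesgue (Caratheodory) measurable sets. *)
Definition lebesgueRn (n : nat) :=
  @completed_measure_extension _ _ _ (borel_lebesgue n).

HB.instance Definition _ (n : nat) := Measure.on (@lebesgueRn n).

End lebesgue_measure_Rn.
Arguments lebesgueRn {R} n _.
Arguments borel_lebesgue {R} n.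

(* A Borel measure on the unit sphere is represented by a Borel measure on R^n
   for which the complement of the sphere is null. *)
Definition is_surface_measure (R : realType) (n : nat)
    (sigma : {measure set (n.-tuple R) -> \bar R}) : Prop :=
  sigma (~` sphere n) = 0 /\
  forall f : n.-tuple R -> \bar R,
    measurable_fun setT f -> (forall x, 0 <= f x) ->
    \int[borel_lebesgue n]_x f x =
    \int[lebesgue_measure]_(t in `]0%R, +oo[)
      \int[sigma]_(x in sphere n) (f (scalet t x) * (t ^+ n.-1)%R%:E).

(* The essential supremum over the sphere is the one over R^n because sigma does
   not charge the complement of the sphere. *)
Definition radial_esssup (R : realType) (n : nat)
    (sigma : {measure set (n.-tuple R) -> \bar R}) (v : n.-tuple R -> \bar R)
    (t : R) : \bar R := ess_sup sigma (fun x => v (scalet t x)).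

(* Extended-real values are allowed, both for nonnegative functions and for
   weights (which are only a.e. positive and finite). *)
Definition Mplus d (T : measurableType d) (R : realType) (A : set T)
    (f : T -> \bar R) : Prop :=
  measurable_fun A f /\ (forall x, A x -> 0 <= f x).

Definition weight d (T : measurableType d) (R : realType)
    (mu : {measure set T -> \bar R}) (A : set T) (w : T -> \bar R) : Prop :=
  measurable_fun A w /\ {ae mu, forall x, A x -> 0 < w x < +oo}.

Section inequalities.
Context {R : realType}.

Notation lebR := (@completed_lebesgue_measure R).
(* The real line with the sigma-algebra of Lebesgue measurable sets, and
   likewise for R^n. *)
Notation LR := (caratheodory_type ((wlength (@idfun R))^*)%mu).
Notation LRn n := (caratheodory_type ((@borel_lebesgue R n)^*)%mu).

Definition weight_halfline (u : R -> \bar R) : Prop :=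
  weight lebR (`]0%R, +oo[ : set R) u.

Definition weight_Rn (n : nat) (v : n.-tuple R -> \bar R) : Prop :=
  weight (lebesgueRn n) setT v.

Definition ball_inequality (n : nat) (q theta : R) (u w : R -> \bar R)
    (v : n.-tuple R -> \bar R) (C : R) : Prop :=
  forall f : n.-tuple R -> \bar R, @Mplus _ (LRn n) R setT f ->
  (\int[lebR]_(t in `]0%R, +oo[)
     ((\int[lebesgueRn n]_(s in eball n t) (f s * v s)) `^ q * u t)) `^ q^-1
  <= C%:E *
  (\int[lebR]_(t in `]0%R, +oo[)
     ((\int[lebesgueRn n]_(s in eball n t) f s) `^ theta * w t)) `^ theta^-1.

Definition halfline_inequality (q theta : R) (u w vt : R -> \bar R)
    (C : R) : Prop :=
  forall g : R -> \bar R, @Mplus _ LR R `]0%R, +oo[ g ->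
  (\int[lebR]_(t in `]0%R, +oo[)
     ((\int[lebR]_(s in `]0%R, t[) (g s * vt s)) `^ q * u t)) `^ q^-1
  <= C%:E *
  (\int[lebR]_(t in `]0%R, +oo[)
     ((\int[lebR]_(s in `]0%R, t[) g s) `^ theta * w t)) `^ theta^-1.

(* +oo when no constant is admissible. *)
Definition best_constant (P : R -> Prop) : \bar R :=
  ereal_inf [set C%:E | C in [set C : R | (0 <= C)%R /\ P C]].

End inequalities.

(* Main.v *)
(* In polar coordinates a function [f] on R^n has the radial density
   [g t = \int_S f(t x) t^(n-1) dsigma(x)], which satisfies
   [\int_B(0,t) f = \int_0^t g] and [\int_B(0,t) f v <= \int_0^t g vt]; so (ii)
   gives (i) with the same constant. Conversely, given [g], one chooses [f] with
   radial density [g], concentrated on each sphere of radius [t] where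
   [v(t .)] is within a factor 2 of its essential supremum [vt t], so that
   [\int_0^t g vt <= 2 \int_B(0,t) f v]. Both constructions need Borel functions
   and Tonelli, so Lebesgue measurable functions are first replaced by Borel
   versions; the essential supremum is only affected for almost no [t]. *)
Require Import Defs.
From HB Require Import structures.
From mathcomp Require Import all_boot all_order all_algebra.
From mathcomp Require Import all_classical all_reals all_analysis.
From mathcomp Require Import measurable_realfun ess_sup_inf.

Set Implicit Arguments.
Unset Strict Implicit.

Import Order.TTheory GRing.Theory Num.Theory.
Import numFieldNormedType.Exports.

Local Open Scope classical_set_scope.
Local Open Scope ring_scope.
Local Open Scope ereal_scope.

(** The inner integrals on the right of (i) and (ii) agree exactly, and those on the left are
    compared for each t, before the power q is taken. The only loss is therefore a factor 2, which
    homogeneity carries through the outer power and its root; this makes the final constant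
    independent of n, q and theta. Two obstacles shape the proof. The essential supremum may be
    infinite on a large set of radii although v is finite, and then no set of directions comes
    within a factor 2 of it. The mass is spread over countably many superlevel sets so that its
    integral against v diverges; explicit superlevel sets also make the choice measurable in t
    without a selection theorem. Moreover, sigma is known only through the polar formula, while
    Tonelli needs it to be sigma-finite and the concentration of mass needs it to be nonzero. Both
    facts are extracted from the formula itself, tested on the unit ball and on the whole space. *)

(** * Sets and functions measurable for a completion *)

Section caratheodory_sandwich.
Context d (T : semiRingOfSetsType d) (R : realType).
Variable mu : {measure set T -> \bar R}.

(** Intersect countable covers of [X] whose total masses exceed the outer measure by at most
    [k.+1%:R^-1]. Finiteness ensures that such almost optimal covers exist. *)
Lemma measurable_hull (X : set T) : mu_ext mu X < +oo ->
  exists F : set T,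
    [/\ (d.-measurable).-sigma.-measurable F, X `<=` F & mu_ext mu F = mu_ext mu X].
Proof.
move=> Xoo.
have Xfin : mu_ext mu X \is a fin_num by rewrite ge0_fin_numE// mu_ext_ge0.
have cover k : exists A : (set T)^nat, measurable_cover X A /\
    \sum_(i <oo) mu (A i) < mu_ext mu X + k.+1%:R^-1%:E.
  have k0 : (0 < k.+1%:R^-1 :> R)%R by rewrite invr_gt0.
  by have [_ [A XA <-] ?] := lb_ereal_inf_adherent k0 Xfin; exists A.
have [A AP] := choice cover.
have XA k : X `<=` \bigcup_i A k i by have [[]] := AP k.
exists (\bigcap_k \bigcup_i A k i); split.
- apply: (@bigcap_measurable _ (g_sigma_algebraType (d.-measurable : set (set T)))).
    by exists 0%N.
  move=> k _; apply: bigcup_measurable => i _; apply: sub_sigma_algebra.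
  by have [[]] := AP k.
- by move=> x Xx k _; exact: XA.
apply/eqP; rewrite eq_le; apply/andP; split; last first.
  by apply: le_mu_ext => x Xx k _; exact: XA.
apply/lee_addgt0Pr => e e0.
have [k ke] : exists k, (k.+1%:R^-1 < e)%R.
  near \oo => k; exists k; near: k; exact: near_infty_natSinv_lt (PosNum e0).
apply: (@le_trans _ _ (mu_ext mu (\bigcup_i A k i))).
  by apply: le_mu_ext; exact: bigcap_inf.
apply: (le_trans (outer_measure_sigma_subadditive (mu_ext mu) _)).
have [[mA _] Ak] := AP k.
rewrite (eq_eseriesr (fun i _ => measurable_mu_extE mu (mA i))).
by apply: (le_trans (ltW Ak)); rewrite leeD2l// lee_fin ltW.
Unshelve. all: by end_near. Qed.

(** On a piece of finite measure the excess of a hull of [E] over [E] is null, by subtraction, but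
    it is only Caratheodory measurable. A second hull, this time of the excess, gives the
    exceptional set [G]. *)
Lemma caratheodory_sandwich (E : set T) : sigma_finite setT mu ->
  caratheodory_measurable (mu_ext mu) E ->
  exists F G : set T, [/\ (d.-measurable).-sigma.-measurable F,
    (d.-measurable).-sigma.-measurable G, mu_ext mu G = 0 &
    forall x, ~ G x -> E x <-> F x].
Proof.
move=> [S ST mS] mE.
have piece i : exists FG : set T * set T,
    [/\ (d.-measurable).-sigma.-measurable FG.1,
        (d.-measurable).-sigma.-measurable FG.2, mu_ext mu FG.2 = 0,
        E `&` S i `<=` FG.1 & FG.1 `\` (E `&` S i) `<=` FG.2].
  have [mSi Sioo] := mS i.
  have ESoo : mu_ext mu (E `&` S i) < +oo.
    apply: le_lt_trans Sioo; rewrite -(measurable_mu_extE mu mSi).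
    by apply: le_mu_ext; exact: subIsetr.
  have [F [mF EF muF]] := measurable_hull ESoo.
  have D0 : mu_ext mu (F `\` (E `&` S i)) = 0.
    have mES : measurable (E `&` S i : set (caratheodory_type (mu_ext mu))).
      by apply: measurableI => //; exact: caratheodory_measurable_mu_ext.
    have mF' : measurable (F : set (caratheodory_type (mu_ext mu))).
      exact: sub_caratheodory.
    have Foo : mu_ext mu F < +oo by rewrite muF.
    transitivity (mu_ext mu F - mu_ext mu (F `&` (E `&` S i))).
      exact: (@measureD _ _ _ (@completed_measure_extension _ _ _ mu)).
    rewrite setIidr//.
    by rewrite muF subee// ge0_fin_numE// mu_ext_ge0.
  have [|G [mG DG muG]] := @measurable_hull (F `\` (E `&` S i)).
    by rewrite D0 ltry.
  by exists (F, G); split => //=; rewrite muG.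
have [FG FGP] := choice piece.
exists (\bigcup_i (FG i).1), (\bigcup_i (FG i).2); split.
- apply: (@bigcup_measurable _ (g_sigma_algebraType (d.-measurable : set (set T)))).
  by move=> i _; have [] := FGP i.
- apply: (@bigcup_measurable _ (g_sigma_algebraType (d.-measurable : set (set T)))).
  by move=> i _; have [] := FGP i.
- apply/eqP; rewrite eq_le mu_ext_ge0// andbT.
  apply: (le_trans (outer_measure_sigma_subadditive (mu_ext mu) _)).
  by rewrite eseries0// => i _ _ /=; have [] := FGP i.
- move=> x nG; split => [Ex|[i _ Fx]].
    have [i _ Six] : (\bigcup_i S i) x by rewrite -ST.
    by exists i => //; have [_ _ _ + _] := FGP i; apply.
  apply: contrapT => nEx; apply: nG; exists i => //.
  by have [_ _ _ _] := FGP i; apply; split => // -[].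
Qed.

End caratheodory_sandwich.

(* [j] stands for the identity of a set carrying two sigma-algebras, the one of
   [T2] being the completion of the one of [T1]. *)
Section completion.
Context d1 d2 (T1 : measurableType d1) (T2 : measurableType d2) (R : realType).
Variables (mu1 : {measure set T1 -> \bar R}) (mu2 : {measure set T2 -> \bar R}).
Variable j : T2 -> T1.
Hypothesis mj : measurable_fun setT j.
Hypothesis mu21 : forall A, measurable A -> mu2 (j @^-1` A) = mu1 A.
Hypothesis sandwich : forall E : set T2, measurable E ->
  exists F G : set T1, [/\ measurable F, measurable G, mu1 G = 0 &
    forall x, ~ G (j x) -> E x <-> F (j x)].
Hypothesis complete2 : measure_is_complete mu2.

(** A nonnegative function is the supremum over rational [r] of [r] times the indicator of its
    superlevel set at [r]. Only countably many sets have to be replaced, so the exceptional sets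
    have a null union. *)
Lemma measurable_version (f : T2 -> \bar R) : measurable_fun setT f ->
  (forall x, 0 <= f x) ->
  exists f1 : T1 -> \bar R, [/\ measurable_fun setT f1, forall x, 0 <= f1 x &
    exists2 G, measurable G /\ mu1 G = 0 & forall x, ~ G (j x) -> f x = f1 (j x)].
Proof.
move=> mf f0.
(* An enumeration of the nonnegative rationals. A number that codes no rational gets level 0, whose
   step function vanishes. *)
pose r k : R := if (unpickle k : option rat) is Some a then `|ratr a|%R else 0%R.
have r0 k : (0 <= r k)%R by rewrite /r; case: unpickle.
have level k : exists FG : set T1 * set T1, [/\ measurable FG.1, measurable FG.2,
    mu1 FG.2 = 0 & forall x, ~ FG.2 (j x) -> ((r k)%:E < f x) <-> FG.1 (j x)].
  have [|F [G [mF mG G0 FGP]]] := @sandwich [set x | (r k)%:E < f x].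
    by rewrite -[X in measurable X]setTI; exact: emeasurable_fun_o_infty.
  by exists (F, G).
have [FG FGP] := choice level.
pose h k x := (r k * \1_((FG k).1) x)%:E.
have mh k : measurable_fun setT (h k).
  apply/measurable_EFinP; apply: measurable_funM => //.
  by apply: measurable_indic; have [] := FGP k.
exists (fun x => ereal_sup (range (h ^~ x))); split.
- rewrite [X in measurable_fun _ X](_ : _ = fun x => esups (h ^~ x) 0%N).
    exact: measurable_fun_esups.
  apply/funext => x; congr ereal_sup; apply/seteqP; split => y [k _ <-].
    by exists k.
  by exists k.
- move=> x; apply: (@le_trans _ _ (h 0%N x)).
    by rewrite lee_fin mulr_ge0// indicE.
  by apply: ereal_sup_ubound; exists 0%N.
exists (\bigcup_k (FG k).2).
  split; first by apply: bigcupT_measurable => k; have [] := FGP k.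
  apply/negligibleP; first by apply: bigcupT_measurable => k; have [] := FGP k.
  by apply: negligible_bigcup => k; apply/negligibleP; have [] := FGP k.
move=> x nG; apply/eqP; rewrite eq_le; apply/andP; split; last first.
  apply: ge_ereal_sup => _ [k _ <-]; rewrite /h indicE.
  have [_ _ _ lev] := FGP k.
  have [|_] := boolP (j x \in (FG k).1); last by rewrite mulr0 f0.
  rewrite inE mulr1 => /lev Fx; apply/ltW/Fx => Gx.
  by apply: nG; exists k.
rewrite leNgt; apply/negP => sup_lt.
have s0 : 0 <= ereal_sup (range (h ^~ (j x))).
  apply: (@le_trans _ _ (h 0%N (j x))).
    by rewrite lee_fin mulr_ge0// indicE.
  by apply: ereal_sup_ubound; exists 0%N.
have [k /andP[sk kf]] : exists k, ereal_sup (range (h ^~ (j x))) < (r k)%:E < f x.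
  move: s0 sup_lt; case: (ereal_sup _) => [s| |]// s0.
  have dens (t : R) : (s < t)%R -> exists k, s%:E < (r k)%:E < t%:E.
    move=> /rat_in_itvoo[a]; rewrite in_itv/= => /andP[sa at_].
    exists (pickle a); rewrite /r pickleK !lte_fin.
    by rewrite ger0_norm ?sa//; apply: (le_trans _ (ltW sa)); rewrite -lee_fin.
  case: (f x) => [t| |]//; first by rewrite lte_fin; exact: dens.
  - move=> _; have s1 : (s < s + 1)%R by rewrite ltrDl.
    have [k /andP[sk _]] := dens _ s1.
    by exists k; rewrite sk ltry.
  by rewrite ltNge leey.
have [_ _ _ lev] := FGP k.
have Fx : (FG k).1 (j x) by apply/lev => // Gx; apply: nG; exists k.
move: sk; apply/negP; rewrite -leNgt; apply: ereal_sup_ubound; exists k => //.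
by rewrite /h indicE mem_set// mulr1.
Qed.

(** Measurability of [f2] is a conclusion, owed to completeness of [mu2]; the integrals agree
    because [mu1] is the image of [mu2] under [j]. *)
Lemma completion_integral (D : set T1) (f2 : T2 -> \bar R) (f1 : T1 -> \bar R)
    (G : set T1) : measurable D -> measurable_fun D f1 ->
  (forall x, D x -> 0 <= f1 x) -> measurable G -> mu1 G = 0 ->
  (forall x, ~ G (j x) -> D (j x) -> f2 x = f1 (j x)) ->
  measurable_fun (j @^-1` D) f2 /\
  \int[mu2]_(x in j @^-1` D) f2 x = \int[mu1]_(x in D) f1 x.
Proof.
move=> mD mf1 f10 mG G0 f21.
have mjD : measurable (j @^-1` D) by rewrite -[X in measurable X]setTI; exact: mj.
have mf1j : measurable_fun (j @^-1` D) (f1 \o j).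
  by apply: (measurable_comp mD) => //; [move=> _ [x ? <-]|exact: measurable_funTS].
have ae12 : ae_eq mu2 (j @^-1` D) (f1 \o j) f2.
  exists (j @^-1` G); split.
  - by rewrite -[X in measurable X]setTI; exact: mj.
  - by rewrite mu21.
  - move=> x /= nf; apply: contrapT => nG; apply: nf => Dx.
    by rewrite f21.
have mf2 : measurable_fun (j @^-1` D) f2 by exact: ae_measurable_fun ae12 mf1j.
split => //.
have -> := ae_eq_integral _ _ mjD mf2 mf1j (ae_eq_sym ae12).
rewrite -(@ge0_integral_pushforward _ _ _ _ _ _ mj mu2 _ f1)//; last first.
  by move=> x; rewrite inE; exact: f10.
by apply: eq_measure_integral => A mA _; rewrite -mu21.
Qed.

Lemma negligible_version (A : set T2) : mu2.-negligible A ->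
  exists G : set T1, [/\ measurable G, mu1 G = 0 & forall x, A x -> G (j x)].
Proof.
move=> [B [mB B0 AB]]; have [F [G [mF mG G0 FG]]] := sandwich mB.
exists (F `|` G); split; first exact: measurableU.
- apply/negligibleP; first exact: measurableU.
  apply: negligibleU; last exact/negligibleP.
  apply/negligibleP => //; apply: (eq_trans (esym (mu21 mF))).
  have mj1 (C : set T1) : measurable C -> measurable (j @^-1` C).
    by move=> mC; rewrite -[X in measurable X]setTI; exact: mj.
  apply/negligibleP; first exact: mj1.
  apply: (@negligibleS _ _ _ _ (B `|` j @^-1` G)).
    by move=> x Fx; have [Gx|nG] := pselect (G (j x)); [right|left; apply/FG].
  apply: negligibleU; apply/negligibleP => //; first exact: mj1.
  by apply: (eq_trans (mu21 mG)).
- move=> x /AB Bx; have [Gx|nG] := pselect (G (j x)); first by right.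
  by left; apply/FG.
Qed.

End completion.

Notation lebR R := (@completed_lebesgue_measure R).
Notation LR R := (caratheodory_type ((wlength (@idfun R))^*)%mu).
Notation LRn R n := (caratheodory_type ((@borel_lebesgue R n)^*)%mu).

(** * Lebesgue measure on the line and on R^n as completions of Borel measures *)

Section lebesgue_completions.
Context {R : realType}.

Definition line_id (x : LR R) : measurableTypeR R := x.

Lemma measurable_line_id : measurable_fun setT line_id.
Proof. by move=> _ A mA; rewrite setTI; exact: sub_caratheodory. Qed.

Lemma line_sandwich (E : set (LR R)) : measurable E ->
  exists F G : set (measurableTypeR R),
  [/\ measurable F, measurable G, lebesgue_measure G = 0 &
    forall x, ~ G (line_id x) -> E x <-> F (line_id x)].
Proof.
move=> mE.
have [F [G [mF mG G0 FG]]] :=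
  caratheodory_sandwich (@wlength_sigma_finite R idfun) mE.
by exists F, G; split.
Qed.

Lemma line_measureE (A : set (measurableTypeR R)) : measurable A ->
  lebR R (line_id @^-1` A) = lebesgue_measure A.
Proof. by []. Qed.

Lemma line_version (f : R -> \bar R) : @measurable_fun _ _ (LR R) _ setT f ->
  (forall x, 0 <= f x) ->
  exists f1 : R -> \bar R, [/\ measurable_fun setT f1, forall x, 0 <= f1 x &
    exists2 G : set R, measurable G /\ lebesgue_measure G = 0 &
      forall x, ~ G x -> f x = f1 x].
Proof. exact: (measurable_version line_sandwich). Qed.

Lemma line_integral (D : set R) (f2 f1 : R -> \bar R) (G : set R) :
  measurable D -> measurable_fun D f1 -> (forall x, D x -> 0 <= f1 x) ->
  measurable G -> lebesgue_measure G = 0 ->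
  (forall x, ~ G x -> D x -> f2 x = f1 x) ->
  @measurable_fun _ _ (LR R) _ D f2 /\
  \int[lebR R]_(x in D) f2 x = \int[lebesgue_measure]_(x in D) f1 x.
Proof.
exact: (completion_integral measurable_line_id line_measureE
  (@completed_lebesgue_measure_is_complete R)).
Qed.

Lemma measurable_halfline : @measurable _ (LR R) `]0%R, +oo[%classic.
Proof.
have := @measurable_line_id measurableT _ (measurable_itv `]0%R, +oo[).
by rewrite setTI; apply.
Qed.

Variable n : nat.

Definition space_id (x : LRn R n) : n.-tuple R := x.

Lemma measurable_space_id : measurable_fun setT space_id.
Proof.
move=> _ A mA; rewrite setTI; apply: sub_caratheodory.
exact: sub_sigma_algebra.
Qed.

Lemma space_measureE (A : set (n.-tuple R)) : measurable A ->
  lebesgueRn n (space_id @^-1` A) = borel_lebesgue n A.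
Proof. by move=> mA; exact: measurable_mu_extE. Qed.

Lemma space_sandwich (E : set (LRn R n)) : measurable E ->
  exists F G : set (n.-tuple R),
  [/\ measurable F, measurable G, borel_lebesgue n G = 0 &
    forall x, ~ G (space_id x) -> E x <-> F (space_id x)].
Proof.
move=> mE.
have [F [G []]] := caratheodory_sandwich (sigma_finiteT (borel_lebesgue n)) mE.
have sE : <<s @measurable _ (n.-tuple R) >> = measurable.
  exact/sigma_algebra_id/sigma_algebra_measurable.
rewrite /measurable/= sE => mF mG G0 FG.
by exists F, G; split => //; rewrite -measurable_mu_extE.
Qed.

Lemma lebesgueRn_complete : measure_is_complete (@lebesgueRn R n).
Proof. exact: measure_is_complete_caratheodory. Qed.

Lemma space_version (f : n.-tuple R -> \bar R) :
  @measurable_fun _ _ (LRn R n) _ setT f -> (forall x, 0 <= f x) ->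
  exists f1 : n.-tuple R -> \bar R,
  [/\ measurable_fun setT f1, forall x, 0 <= f1 x &
    exists2 G : set (n.-tuple R), measurable G /\ borel_lebesgue n G = 0 &
      forall x, ~ G x -> f x = f1 x].
Proof. exact: (measurable_version space_sandwich). Qed.

Lemma space_integral (D : set (n.-tuple R)) (f2 f1 : n.-tuple R -> \bar R)
    (G : set (n.-tuple R)) :
  measurable D -> measurable_fun D f1 -> (forall x, D x -> 0 <= f1 x) ->
  measurable G -> borel_lebesgue n G = 0 ->
  (forall x, ~ G x -> D x -> f2 x = f1 x) ->
  @measurable_fun _ _ (LRn R n) _ D f2 /\
  \int[lebesgueRn n]_(x in D) f2 x = \int[borel_lebesgue n]_(x in D) f1 x.
Proof.
exact: (completion_integral measurable_space_id space_measureE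
  lebesgueRn_complete).
Qed.

Lemma space_negligible (A : set (n.-tuple R)) : (lebesgueRn n).-negligible A ->
  exists G : set (n.-tuple R),
    [/\ measurable G, borel_lebesgue n G = 0 & A `<=` G].
Proof.
exact: (negligible_version measurable_space_id space_measureE space_sandwich).
Qed.

End lebesgue_completions.

(** * Monotonicity and homogeneity of the outer weighted integrals *)

Section weighted_power_mean.
Context d (T : measurableType d) (R : realType).
Variables (mu : {measure set T -> \bar R}) (D : set T) (u : T -> \bar R) (q : R).
Hypotheses (mD : measurable D) (q0 : (0 < q)%R) (wu : weight mu D u).

Let mu' : measurable_fun D u^\+.
Proof. by apply: measurable_funepos; case: wu. Qed.

Let u'0 x : D x -> 0 <= u^\+ x.
Proof. by move=> _; rewrite funeposE le_max lexx orbT. Qed.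

Let mpow (h : T -> \bar R) : measurable_fun D h ->
  measurable_fun D (fun x => h x `^ q).
Proof. by move=> mh; apply: (measurableT_comp (measurable_poweR q)). Qed.

(** A weight may be negative on a null set, where the integrand would not be monotone in [h].
    Passing to the positive part restores pointwise monotonicity without changing the integral. *)
Let weight_posE (h : T -> \bar R) : measurable_fun D h ->
  \int[mu]_(x in D) (h x `^ q * u x) = \int[mu]_(x in D) (h x `^ q * u^\+ x).
Proof.
move=> mh; apply: ae_eq_integral => //.
- by apply: emeasurable_funM; [exact: mpow|case: wu].
- by apply: emeasurable_funM => //; exact: mpow.
- case: wu => _; apply: filterS => x ux Dx.
  by rewrite funeposE max_l//; case/andP: (ux Dx) => /ltW.
Qed.

Lemma le_weighted_power_mean (h1 h2 : T -> \bar R) :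
  measurable_fun D h1 -> measurable_fun D h2 ->
  (forall x, D x -> 0 <= h1 x <= h2 x) ->
  (\int[mu]_(x in D) (h1 x `^ q * u x)) `^ q^-1 <=
  (\int[mu]_(x in D) (h2 x `^ q * u x)) `^ q^-1.
Proof.
move=> mh1 mh2 h12; rewrite !weight_posE//.
have q'0 : (0 <= q^-1)%R by rewrite invr_ge0 ltW.
have ge0 (h : T -> \bar R) x : D x -> 0 <= h x `^ q * u^\+ x.
  by move=> Dx; rewrite mule_ge0 ?poweR_ge0 ?u'0.
apply: (gt0_ler_poweR q'0).
- by rewrite in_itv/= leey andbT; apply: integral_ge0 => x; exact: ge0.
- by rewrite in_itv/= leey andbT; apply: integral_ge0 => x; exact: ge0.
apply: ge0_le_integral => //.
- by move=> x; exact: ge0.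
- by apply: emeasurable_funM => //; exact: mpow.
- by apply: emeasurable_funM => //; exact: mpow.
move=> x Dx; apply: lee_wpmul2r; first exact: u'0.
have /andP[h10 h1h2] := h12 _ Dx.
apply: (gt0_ler_poweR (ltW q0)) => //; rewrite in_itv/= leey andbT//.
exact: le_trans h1h2.
Qed.

Lemma weighted_power_meanZ (c : R) (h : T -> \bar R) : (0 <= c)%R ->
  measurable_fun D h -> (forall x, D x -> 0 <= h x) ->
  (\int[mu]_(x in D) ((c%:E * h x) `^ q * u x)) `^ q^-1 =
  c%:E * (\int[mu]_(x in D) (h x `^ q * u x)) `^ q^-1.
Proof.
move=> c0 mh h0; rewrite !weight_posE//; last exact: emeasurable_funM.
have mhu : measurable_fun D (fun x => h x `^ q * u^\+ x).
  by apply: emeasurable_funM => //; exact: mpow.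
have hu0 x : D x -> 0 <= h x `^ q * u^\+ x.
  by move=> Dx; rewrite mule_ge0 ?poweR_ge0 ?u'0.
transitivity ((\int[mu]_(x in D) ((c `^ q)%:E * (h x `^ q * u^\+ x))) `^ q^-1).
  congr (_ `^ _); apply: eq_integral => x; rewrite inE => Dx.
  by rewrite poweRM ?h0// muleA.
rewrite ge0_integralZl_EFin ?powR_ge0// poweRM ?integral_ge0 ?lee_fin ?powR_ge0//.
by rewrite poweR_EFin -powRrM mulfV ?gt_eqF// powRr1.
Qed.

End weighted_power_mean.

(** * Measurability and size estimates in R^n *)

Section euclidean.
Context {R : realType}.

Lemma measurable_scalet n :
  measurable_fun setT (fun p : measurableTypeR R * n.-tuple R => scalet p.1 p.2).
Proof.
apply/measurable_fun_tnthP => i.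
rewrite (_ : _ \o _ = fun p => (p.1 * tnth p.2 i)%R); last first.
  by apply/funext => p /=; rewrite tnth_mktuple.
apply: measurable_funM => //.
exact: (measurableT_comp (measurable_tnth i) measurable_snd).
Qed.

Lemma measurable_scalet1 n (t : R) : measurable_fun setT (@scalet R n t).
Proof.
apply/measurable_fun_tnthP => i.
rewrite (_ : _ \o _ = fun x => (t * tnth x i)%R); last first.
  by apply/funext => x /=; rewrite tnth_mktuple.
by apply: measurable_funM => //; exact: measurable_tnth.
Qed.

Lemma measurable_enorm n : measurable_fun setT (@enorm R n).
Proof.
have msum : measurable_fun setT (fun x : n.-tuple R => \sum_(i < n) tnth x i ^+ 2)%R.
  by apply: measurable_sum => i; apply: measurable_funX; exact: measurable_tnth.
exact: (measurableT_comp (continuous_measurable_fun (@sqrt_continuous R)) msum).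
Qed.

Lemma enorm_scalet n (a : R) (x : n.-tuple R) : (0 <= a)%R ->
  enorm (scalet a x) = (a * enorm x)%R.
Proof.
move=> a0; rewrite /enorm.
under eq_bigr do rewrite tnth_mktuple exprMn.
by rewrite -mulr_sumr sqrtrM ?sqr_ge0// sqrtr_sqr ger0_norm.
Qed.

Lemma measurable_eball n (t : R) : measurable (@eball R n t).
Proof.
rewrite -[eball _ _]setTI.
exact: (measurable_fun_ltr (@measurable_enorm n) (@measurable_cst _ _ _ _ _ t))
  measurableT [set true] _.
Qed.

Lemma measurable_sphere n : measurable (@sphere R n).
Proof.
have := @measurable_enorm n measurableT [set 1%R] (measurable_set1 _).
by rewrite setTI.
Qed.

(** A product set containing the unit ball: its measure can be bounded by induction on [n], which
    the ball itself does not allow directly. *)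
Definition cube n : set (n.-tuple R) := [set x | forall i, `|tnth x i| <= 1]%R.

Arguments cube n _ : clear implicits.

Lemma cubeS n : @tcons R n @^-1` cube n.+1 = `[(-1)%R, 1%R]%classic `*` cube n.
Proof.
apply/seteqP; split => -[a x] /=.
  move=> cx; split => [|i]; first by have := cx ord0; rewrite tnth0 ler_norml in_itv.
  by have := cx (lift ord0 i); rewrite tnthS.
move=> [a1 cx] i; have [->|[k ->]] : i = ord0 \/ exists k, i = lift ord0 k.
- by case: (unliftP ord0 i) => [k|] ->; [right; exists k|left].
- by rewrite tnth0 ler_norml; move: a1; rewrite in_itv.
- by rewrite tnthS; exact: cx.
Qed.

Lemma measurable_cube n : measurable (@cube n).
Proof.
rewrite (_ : cube n = \bigcap_(i in [set: 'I_n]) [set x | (`|tnth x i| <= 1)%R]); last first.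
  by apply/seteqP; split => x cx i => [_|]; exact: cx.
apply: fin_bigcap_measurable => // i _.
have mi : measurable_fun setT (fun x : n.-tuple R => `|tnth x i|%R).
  by apply: measurableT_comp; [exact: normr_measurable|exact: measurable_tnth].
have mle := measurable_fun_ler mi (@measurable_cst _ _ _ _ _ (1%R : R)).
by have := mle measurableT [set true] I; rewrite setTI.
Qed.

Lemma borel_lebesgue_cube n : @borel_lebesgue R n (cube n) < +oo.
Proof.
elim: n => [|n IH] /=; first by rewrite /lebesgue0 diracE; case: (_ \in _); rewrite ltry.
rewrite /lebesgueS /pushforward cubeS product_measure1E//; last exact: measurable_cube.
have I2 : lebesgue_measure (`[(-1)%R, 1%R]%classic : set R) = 2%:E.
  rewrite lebesgue_measure_itv/= lte_fin (lt_trans (ltrN10 R) ltr01).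
  by rewrite -EFinB opprK.
by rewrite [X in X * _]I2 lte_mul_pinfty.
Qed.

Lemma borel_lebesgue_eball1 n : @borel_lebesgue R n (eball n 1) < +oo.
Proof.
apply: le_lt_trans (borel_lebesgue_cube n); apply: le_measure.
- by rewrite inE; exact: measurable_eball.
- by rewrite inE; exact: measurable_cube.
move=> x /= xb i.
rewrite -sqrtr_sqr (le_trans _ (ltW xb))// ler_sqrt//.
  by rewrite (bigD1 i)//= lerDl sumr_ge0// => k _; exact: sqr_ge0.
by rewrite sumr_ge0// => k _; exact: sqr_ge0.
Qed.

(** This will exclude a vanishing surface measure. *)
Lemma borel_lebesgueT_gt0 n : 0 < @borel_lebesgue R n setT.
Proof.
elim: n => [|n IH] /=; first by rewrite /lebesgue0 diracT lte01.
rewrite /lebesgueS /pushforward preimage_setT -setXTT product_measure1E//.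
have leb_oo : lebesgue_measure (setT : set R) = +oo.
  by rewrite -set_itvNyy lebesgue_measure_itv.
by rewrite [X in X * _]leb_oo gt0_mulye.
Qed.

End euclidean.

(** * Consequences of the polar formula for the surface measure *)

Section polar_coordinates.
Context {R : realType} {n : nat}.
Variable sigma : {measure set (n.-tuple R) -> \bar R}.
Hypothesis surface : is_surface_measure sigma.

Definition polar_density (F : n.-tuple R -> \bar R) (t : R) : \bar R :=
  \int[sigma]_(x in sphere n) (F (scalet t x) * (t ^+ n.-1)%R%:E).

Lemma integral_eball (F : n.-tuple R -> \bar R) (t : R) :
  measurable_fun setT F -> (forall x, 0 <= F x) ->
  \int[borel_lebesgue n]_(x in eball n t) F x =
  \int[lebesgue_measure]_(r in `]0%R, t[) polar_density F r.
Proof.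
move=> mF F0; rewrite integral_mkcond surface.2; last 2 first.
- by apply/(measurable_restrictT _ (measurable_eball t)); exact: measurable_funTS.
- by move=> x; rewrite patchE; case: ifP.
rewrite (_ : `]0%R, t[%classic = `]0%R, +oo[%classic `&` `]-oo, t[%classic); last first.
  apply/seteqP; split => r /=; rewrite !in_itv/= ?andbT; first by move=> /andP[-> ->].
  by move=> [-> ->].
rewrite integral_mkcondr; apply: eq_integral => r; rewrite inE/= in_itv/= andbT => r0.
rewrite [RHS]patchE mem_setE in_itv/=.
have rS x : sphere n x -> enorm (scalet r x) = r.
  by move=> x1; rewrite enorm_scalet ?ltW// x1 mulr1.
(* All points of the sphere of radius [r] lie in the ball if [r < t], and none otherwise. *)
case: ifPn => rt; [apply: eq_integral|apply: integral0_eq] => x.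
  by rewrite inE => /rS xr; rewrite patchE ifT//; apply/mem_set; rewrite /eball /= xr.
move=> /rS xr; rewrite patchE ifF ?mul0e//; apply/negbTE; rewrite notin_setE.
by rewrite /eball /= xr; exact/negP.
Qed.

Lemma surface_measureT : sigma setT = sigma (sphere n).
Proof.
have mS := @measurable_sphere R n.
have := measureU sigma (measurableC mS) mS (setICl _).
by rewrite setvU => ->; rewrite [X in X + _]surface.1 add0e.
Qed.

Lemma polar_density1 (r : R) :
  polar_density (cst 1) r = (r ^+ n.-1)%R%:E * sigma setT.
Proof.
rewrite /polar_density surface_measureT.
under eq_integral do rewrite mul1e.
by rewrite integral_cst//; exact: measurable_sphere.
Qed.

(** An infinite mass would make the integrand in the polar formula infinite at every radius, and
    hence the unit ball of infinite measure. *)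
Lemma surface_measure_lty : sigma setT < +oo.
Proof.
rewrite ltNge leye_eq; apply/negP => /eqP soo.
have := borel_lebesgue_eball1 (R := R) n.
have -> : borel_lebesgue n (eball n 1%R) = +oo :> \bar R; last by rewrite ltxx.
rewrite -[LHS]mul1e -(@integral_cst _ _ _ _ _ (measurable_eball 1%R)).
rewrite integral_eball//.
transitivity (\int[lebesgue_measure]_(r in `]0%R, 1%R[) (+oo : \bar R)).
  apply: eq_integral => r; rewrite inE/= in_itv/= => /andP[r0 _].
  by rewrite polar_density1 soo gt0_muley// lte_fin exprn_gt0.
have leb01 : lebesgue_measure (`]0%R, 1%R[%classic : set R) = 1.
  by rewrite lebesgue_measure_itv/= lte_fin ltr01 sube0.
by rewrite integral_cst// [X in _ * X]leb01 mule1.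
Qed.

(** For [sigma] of mass zero the polar formula would give measure zero to the whole space. *)
Lemma surface_measure_gt0 : 0 < sigma setT.
Proof.
rewrite lt0e measure_ge0 andbT; apply/negP => /eqP s0.
have := borel_lebesgueT_gt0 (R := R) n.
rewrite -[X in 0 < X]mul1e -(@integral_cst _ _ _ _ _ measurableT) surface.2//.
rewrite integral0_eq ?ltxx// => r _.
by rewrite -/(polar_density (cst 1) r) polar_density1 s0 mule0.
Qed.

End polar_coordinates.

(** * Sections, essential suprema and concentrated densities with a parameter *)

Section parametrized_finite_measure.
Context d1 d2 (X : measurableType d1) (T : measurableType d2) (R : realType).
Variable mu : {measure set T -> \bar R}.
Hypothesis muoo : mu setT < +oo.

(** Tonelli is stated for bundled sigma-finite measures, whereas [mu] comes as a bare measure;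
    finiteness provides the bundle. *)
Let sigma_finite_version :
  exists m : {sigma_finite_measure set T -> \bar R}, mu = m :> {measure set T -> \bar R}.
Proof.
have fin : fin_num_fun mu.
  move=> A mA; rewrite ge0_fin_numE//; apply: le_lt_trans muoo.
  by apply: le_measure => //; rewrite inE.
have sfin : sigma_finite setT mu.
  by apply: fin_num_fun_sigma_finite => //; rewrite measure0.
pose H2 := isSFinite.Build _ _ _ _ (sfinite_measure_sigma_finite sfin).
pose H3 := isSigmaFinite.Build _ _ _ _ sfin.
pose m : {sigma_finite_measure set T -> \bar R} :=
  HB.pack_for (SigmaFiniteMeasure.type T R) (Measure.sort mu) H2 H3.
by exists m; exact: eq_measure.
Qed.

Lemma measurable_integral_param (h : X * T -> \bar R) : measurable_fun setT h ->
  (forall p, 0 <= h p) -> measurable_fun setT (fun x => \int[mu]_y h (x, y)).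
Proof.
move=> mh h0; have [m ->] := sigma_finite_version.
exact: (measurable_fun_fubini_tonelli_F (m2 := m) _ mh h0).
Qed.

Lemma measurable_measure_xsection (A : set (X * T)) : measurable A ->
  measurable_fun setT (fun x => mu (xsection A x)).
Proof.
move=> mA; have [m ->] := sigma_finite_version.
exact: (measurable_fun_xsection m mA).
Qed.

(** The essential supremum at [x] exceeds [r] exactly when the section at [x] of the superlevel set
    of [v] has nonzero measure, and this measure is measurable in [x]. *)
Lemma measurable_ess_sup (v : X * T -> \bar R) : measurable_fun setT v ->
  measurable_fun setT (fun x => ess_sup mu (fun y => v (x, y))).
Proof.
move=> mv.
apply: (measurability _ (ErealGenOInfty.measurableE R)) => // _ [_ [r ->] <-].
rewrite setTI.
have mA : measurable [set p | r%:E < v p].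
  by rewrite -[X in measurable X]setTI; exact: emeasurable_fun_o_infty.
rewrite (_ : _ @^-1` _ =
    (fun x => mu (xsection [set p | r%:E < v p] x)) @^-1` [set~ 0]).
  rewrite -[X in measurable X]setTI.
  by apply: measurable_measure_xsection => //; exact: measurableC.
have xE x : (ess_sup mu (fun y => v (x, y)) <= r%:E) <->
    mu (xsection [set p | r%:E < v p] x) = 0.
  have mvx : measurable_fun setT (fun y => v (x, y)).
    exact: measurableT_comp mv (pair1_measurable x).
  have pre : (fun y => v (x, y)) @^-1` `]r%:E, +oo[ = xsection [set p | r%:E < v p] x.
    by apply/seteqP; split => y; rewrite /xsection/= in_itv/= andbT inE.
  split; first by move=> /ess_supP/(ae_le_measureP mu _ mvx); rewrite pre.
  by move=> m0; apply/ess_supP/(ae_le_measureP mu _ mvx); rewrite pre.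
apply/seteqP; split => x; rewrite /= in_itv/= andbT => xr.
  by move=> /xE; rewrite leNgt xr.
by rewrite ltNge; apply/negP => /xE.
Qed.

Let half_sum1 : \sum_(k <oo) ((2 ^ k.+1)%:R^-1 : R)%:E = 1.
Proof.
apply/cvg_lim => //.
rewrite (_ : (fun N => _) = eseries (fun k => (1 / (2 ^ (k + 1))%:R : R)%:E)).
  by have := @cvg_geometric_eseries_half R 1%R 0%N; rewrite expr0 divr1.
by apply/funext => N; apply: eq_bigr => k _; rewrite addn1 div1r.
Qed.

(* The [k]-th summand of [h] spreads mass [2 ^- k.+1] uniformly over the set
   where [v (x, .)] exceeds [V / 2], or [2 ^ k.+1] if [V = +oo]: in the latter
   case every summand contributes at least 1 to the integral of [h * v]. *)
Lemma concentrated_density (v : X * T -> R) : measurable_fun setT v ->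
  (forall p, (0 < v p)%R) -> 0 < mu setT ->
  exists h : X * T -> \bar R, [/\ measurable_fun setT h, forall p, 0 <= h p,
    forall x, \int[mu]_y h (x, y) = 1 &
    forall x, ess_sup mu (fun y => (v (x, y))%:E) <=
      2%:E * \int[mu]_y (h (x, y) * (v (x, y))%:E)].
Proof.
move=> mv v0 mu0.
have mEv : measurable_fun setT (EFin \o v) by exact/measurable_EFinP.
pose V x := ess_sup mu (fun y => (v (x, y))%:E).
have mV : measurable_fun setT V := measurable_ess_sup mEv.
have V0 x : 0 < V x.
  rewrite ltNge; apply/negP => /ess_supP[N [mN N0 vN]].
  have NT : N = setT.
    by apply/seteqP; split => // y _; apply: vN => /=; rewrite lee_fin leNgt v0.
  by move: mu0; rewrite -NT N0 ltxx.
pose phi k x := if V x == +oo then ((2 ^ k.+1)%:R : R)%:E else V x * (2^-1)%:E.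
have phi0 k x : 0 <= phi k x.
  by rewrite /phi; case: ifP => _; rewrite ?lee_fin// mule_ge0// ltW.
have phiV k x : phi k x < V x.
  rewrite /phi; case: eqVneq => [->|Voo]; first by rewrite ltry.
  have Vfin : V x \is a fin_num by rewrite ge0_fin_numE ?ltW// ltey.
  have := V0 x; rewrite -(fineK Vfin) -EFinM !lte_fin => fV0.
  by rewrite ltr_pdivrMr// ltr_pMr// ltr1n.
have mphi k : measurable_fun setT (phi k).
  apply: measurable_fun_ifT => //; first exact: measurable_fun_eqe.
  exact: emeasurable_funM.
pose A k := [set p : X * T | phi k p.1 < (v p)%:E].
have mA k : measurable (A k).
  rewrite -[X in measurable X]setTI; apply: measurable_lte => //.
  exact: measurableT_comp.
pose m k x := mu (xsection (A k) x).
have mxA k x : measurable (xsection (A k) x) by exact: measurable_xsection.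
have mfin k x : m k x \is a fin_num.
  rewrite ge0_fin_numE//; apply: le_lt_trans muoo.
  by apply: le_measure => //; rewrite inE.
(* Were the level set null, [phi k x] would be an essential upper bound; this is why [phiV] is
   strict. *)
have m0 k x : 0 < m k x.
  rewrite lt0e measure_ge0 andbT; apply/negP => /eqP m0.
  have := phiV k x; rewrite ltNge => /negP; apply.
  apply/ess_supP; exists (xsection (A k) x); split => // y /= nle.
  by rewrite /xsection/= inE /A/= ltNge; exact/negP.
(* The height giving the [k]-th level set mass [2 ^- k.+1], for a total mass of 1. The inverse is a
   power -1 so that its measurability follows from [measurable_powR]. *)
pose a k x := ((2 ^ k.+1)%:R^-1 * (fine (m k x)) `^ (-1))%R.
have a0 k x : (0 <= a k x)%R by rewrite mulr_ge0 ?powR_ge0.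
have am k x : (a k x)%:E * m k x = ((2 ^ k.+1)%:R^-1 : R)%:E.
  rewrite -(fineK (mfin k x)) -EFinM /a powR_inv1 ?fine_ge0// -mulrA mulVf ?mulr1//.
  by rewrite fine_eq0// gt_eqF.
have ma k : measurable_fun setT (a k).
  apply: measurable_funM => //.
  have mm : measurable_fun setT (fun x => fine (m k x)).
    by apply: measurableT_comp => //; exact: measurable_measure_xsection.
  exact: (measurableT_comp (@measurable_powR R (-1)%R) mm).
pose b k p := (a k p.1 * \1_(A k) p)%:E.
have mb k : measurable_fun setT (b k).
  apply/measurable_EFinP; apply: measurable_funM; first exact: measurableT_comp.
  exact: measurable_indic.
have b0 k p : 0 <= b k p by rewrite lee_fin mulr_ge0// indicE.
have mbx k x : measurable_fun setT (fun y => b k (x, y)).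
  exact: measurableT_comp (mb k) (pair1_measurable x).
have mvx x : measurable_fun setT (fun y => (v (x, y))%:E).
  exact: measurableT_comp mEv (pair1_measurable x).
have int_b k x : \int[mu]_y b k (x, y) = ((2 ^ k.+1)%:R^-1 : R)%:E.
  rewrite -(am k x) /m -(setIT (xsection _ _)) -(integral_indic _ measurableT (mxA k x)).
  rewrite -ge0_integralZl_EFin//; last first.
    by apply/measurable_EFinP; exact: measurable_indic.
  apply: eq_integral => y _.
  have -> : \1_(xsection (A k) x) y = \1_(A k) (x, y) :> R by rewrite !indicE mem_xsection.
  by rewrite -EFinM.
pose h p := \sum_(k <oo) b k p.
exists h; split.
- exact: (ge0_emeasurable_sum (P := xpredT)).
- by move=> p; apply: nneseries_ge0 => k _ _.
- move=> x; rewrite /h integral_nneseries//.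
  by under eq_eseriesr do rewrite int_b.
move=> x.
have -> : \int[mu]_y (h (x, y) * (v (x, y))%:E) =
    \sum_(k <oo) \int[mu]_y ((v (x, y))%:E * b k (x, y)).
  rewrite -integral_nneseries//.
  - by apply: eq_integral => y _; rewrite muleC /h -nneseriesZl.
  - by move=> k; apply: emeasurable_funM.
  - by move=> k y _; rewrite mule_ge0// lee_fin ltW.
(* The [k]-th summand of [h] lives on [A k], where [v] may be bounded below by the constant
   [phi k x]. *)
apply: (@le_trans _ _ (2%:E * \sum_(k <oo) (phi k x * ((2 ^ k.+1)%:R^-1 : R)%:E))); last first.
  apply: lee_wpmul2l; first by rewrite lee_fin.
  apply: lee_nneseries => [k _ _|k _]; first by apply: mule_ge0 => //; rewrite lee_fin.
  rewrite -(int_b k x) -ge0_integralZl//.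
  apply: ge0_le_integral => //.
  - by move=> y _; rewrite mule_ge0.
  - exact: emeasurable_funM.
  - exact: emeasurable_funM.
  move=> y _; rewrite /b indicE; have [yA|] := boolP (_ \in _); last by rewrite mulr0 !mule0.
  by apply: lee_wpmul2r; [rewrite lee_fin mulr_ge0|apply/ltW; move: yA; rewrite inE].
have [Voo|Voo] := eqVneq (V x) +oo.
  rewrite (_ : \sum_(k <oo) _ = +oo) ?gt0_muley ?leey//.
  under eq_eseriesr => k _.
    by rewrite /phi Voo eqxx -EFinM mulfV; [over|rewrite pnatr_eq0 expn_eq0].
  apply/eqyP => r r0.
  apply: le_trans (nneseries_lim_ge (Num.truncn r).+1 _) => //=.
  rewrite big_mkord sumEFin sumr_const card_ord lee_fin.
  by rewrite ltW// truncnS_gt.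
(* Every level is half of [V x] and the masses sum to 1, so the factor 2 gives equality. *)
rewrite /phi (negbTE Voo).
have Vfin : V x \is a fin_num by rewrite ge0_fin_numE ?ltW// ltey.
rewrite -/(V x) -(fineK Vfin) -EFinM nneseriesZl// half_sum1 mule1 -EFinM.
by rewrite mulrC divfK.
Qed.

End parametrized_finite_measure.

(** * Polar densities and the radial essential supremum *)

Section radial_reduction.
Context {R : realType} {n : nat}.
Variable sigma : {measure set (n.-tuple R) -> \bar R}.
Hypothesis surface : is_surface_measure sigma.

Notation V0 v := (radial_esssup sigma (EFin \o v)).

Lemma integral_sphere (F : n.-tuple R -> \bar R) :
  measurable_fun setT F -> (forall x, 0 <= F x) ->
  \int[sigma]_(x in sphere n) F x = \int[sigma]_x F x.
Proof.
move=> mF F0; have mSc := measurableC (@measurable_sphere R n).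
have [S0 _] := surface.
rewrite [RHS](ge0_negligible_integral mSc measurableT mF (fun x _ => F0 x) S0).
by rewrite setDE setCK setTI.
Qed.

Lemma measurable_polar_density (F : n.-tuple R -> \bar R) :
  measurable_fun setT F -> (forall x, 0 <= F x) ->
  measurable_fun (`]0%R, +oo[%classic : set R) (polar_density sigma F).
Proof.
move=> mF F0.
(* The absolute value keeps [h] nonnegative for negative radii too, as Tonelli on the full line
   requires. *)
pose h (p : measurableTypeR R * n.-tuple R) :=
  F (scalet p.1 p.2) * (`|p.1| ^+ n.-1)%R%:E.
have mh : measurable_fun setT h.
  apply: emeasurable_funM; first exact: (measurableT_comp mF (@measurable_scalet R n)).
  apply/measurable_EFinP; apply: measurable_funX.
  exact: (measurableT_comp (@normr_measurable R setT) measurable_fst).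
have h0 p : 0 <= h p by rewrite mule_ge0// lee_fin exprn_ge0.
have := measurable_integral_param (surface_measure_lty surface) mh h0.
move=> mI; apply: eq_measurable_fun (measurable_funTS mI) => r; rewrite inE/= in_itv/= andbT => r0.
rewrite -integral_sphere//; last exact: measurableT_comp mh (pair1_measurable _).
by apply: eq_integral => x _; rewrite /h/= gtr0_norm.
Qed.

Lemma polar_density_ge0 (F : n.-tuple R -> \bar R) (r : R) : (0 < r)%R ->
  (forall x, 0 <= F x) -> 0 <= polar_density sigma F r.
Proof.
move=> r0 F0; apply: integral_ge0 => x _.
by rewrite mule_ge0// lee_fin exprn_ge0// ltW.
Qed.

Lemma radial_esssup_ge0 (v : n.-tuple R -> R) (r : R) :
  (forall x, (0 < v x)%R) -> 0 <= V0 v r.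
Proof.
move=> v0; apply: ess_sup_gee; first exact: surface_measure_gt0.
by apply: aeW => x /=; rewrite lee_fin ltW.
Qed.

Lemma measurable_radial_esssup (v : n.-tuple R -> R) : measurable_fun setT v ->
  measurable_fun (setT : set R) (V0 v).
Proof.
move=> mv; have mEv : measurable_fun setT (EFin \o v) by exact/measurable_EFinP.
exact: (measurable_ess_sup (surface_measure_lty surface)
  (measurableT_comp mEv (@measurable_scalet R n))).
Qed.

(** On the sphere of radius [r], [v] is bounded by its essential supremum off a [sigma]-null set, so
    the comparison of integrands holds almost everywhere only. *)
Lemma polar_densityM_le (F : n.-tuple R -> \bar R) (v : n.-tuple R -> R) (r : R) :
  measurable_fun setT F -> (forall x, 0 <= F x) ->
  measurable_fun setT v -> (forall x, (0 < v x)%R) -> (0 < r)%R ->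
  polar_density sigma (fun x => F x * (v x)%:E) r <=
  polar_density sigma F r * V0 v r.
Proof.
move=> mF F0 mv v0 r0; have mS := @measurable_sphere R n.
have mFr : measurable_fun setT (fun x => F (scalet r x) * (r ^+ n.-1)%R%:E).
  apply: emeasurable_funM => //.
  exact: (measurableT_comp mF (@measurable_scalet1 R n r)).
have Fr0 x : 0 <= F (scalet r x) * (r ^+ n.-1)%R%:E.
  by rewrite mule_ge0// lee_fin exprn_ge0// ltW.
have mvr : measurable_fun setT (fun x => (v (scalet r x))%:E).
  apply/measurable_EFinP.
  exact: (measurableT_comp mv (@measurable_scalet1 R n r)).
rewrite /polar_density -ge0_integralZr//; last 2 first.
- exact: measurable_funTS.
- exact: radial_esssup_ge0.
under [leLHS]eq_integral do rewrite muleAC.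
apply: ae_ge0_le_integral => //.
- by move=> x _; apply: mule_ge0; rewrite // lee_fin ltW.
- by apply: measurable_funTS; exact: emeasurable_funM.
- by move=> x _; rewrite mule_ge0//; exact: radial_esssup_ge0.
- by apply: measurable_funTS; exact: emeasurable_funM.
have := ess_sup_ge sigma (fun x => (v (scalet r x))%:E).
by apply: filterS => x vx _; exact: lee_wpmul2l.
Qed.

Lemma scaletA (a b : R) (x : n.-tuple R) : scalet a (scalet b x) = scalet (a * b) x.
Proof. by apply/eq_from_tnth => i; rewrite !tnth_mktuple mulrA. Qed.

Lemma scale1t (x : n.-tuple R) : scalet 1 x = x.
Proof. by apply/eq_from_tnth => i; rewrite !tnth_mktuple mul1r. Qed.

(** With radii as parameters and directions as points, [concentrated_density] supplies a
    distribution of unit mass for each radius; multiplying it by [g r] prescribes the radial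
    density. *)
Lemma concentrated_function (g : R -> \bar R) (v : n.-tuple R -> R) :
  measurable_fun setT g -> (forall r, 0 <= g r) ->
  measurable_fun setT v -> (forall x, (0 < v x)%R) ->
  exists F : n.-tuple R -> \bar R, [/\ measurable_fun setT F,
    forall x, 0 <= F x &
    forall r : R, (0 < r)%R -> polar_density sigma F r = g r /\
      g r * V0 v r <= 2%:E * polar_density sigma (fun x => F x * (v x)%:E) r].
Proof.
move=> mg g0 mv v0.
have [] := @concentrated_density _ _ (measurableTypeR R) _ _ sigma
  (surface_measure_lty surface) (fun p => v (scalet p.1 p.2)).
- exact: (measurableT_comp mv (@measurable_scalet R n)).
- by move=> p; exact: v0.
- exact: surface_measure_gt0.
move=> h [mh h0 h1 hV].
(* For [r > 0] and [x] on the sphere, [enorm] and [dir] recover [r] and [x] from [scalet r x]. *)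
pose dir (y : n.-tuple R) := scalet (enorm y `^ (-1)) y.
have mnorm := @measurable_enorm R n.
have mdir : measurable_fun setT (fun y => (enorm y : measurableTypeR R, dir y)).
  apply/measurable_fun_pair => //=.
  have mpair : measurable_fun setT
      (fun y : n.-tuple R => (enorm y `^ (-1) : measurableTypeR R, y)%R).
    apply/measurable_fun_pair => //=.
    exact: (measurableT_comp (@measurable_powR R (-1)%R) mnorm).
  exact: (measurableT_comp (@measurable_scalet R n) mpair).
(* The middle factor cancels the Jacobian of the polar density. *)
pose F y := g (enorm y) * ((enorm y ^+ n.-1) `^ (-1))%R%:E * h (enorm y, dir y).
have FE r x : (0 < r)%R -> sphere n x ->
    F (scalet r x) * (r ^+ n.-1)%R%:E = g r * h (r, x).
  move=> r0 x1; have rn0 : (0 < r ^+ n.-1)%R by exact: exprn_gt0.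
  have nr : enorm (scalet r x) = r by rewrite enorm_scalet ?ltW// x1 mulr1.
  rewrite /F /dir nr scaletA !powR_inv1 ?ltW// mulVf ?gt_eqF// scale1t.
  by rewrite muleAC -(muleA (g r)) -EFinM mulVf ?gt_eqF// mule1.
have mhr r : measurable_fun setT (fun x => h (r, x)).
  exact: measurableT_comp mh (pair1_measurable _).
exists F; split.
- apply: emeasurable_funM; last exact: (measurableT_comp mh mdir).
  apply: emeasurable_funM; first exact: measurableT_comp.
  apply/measurable_EFinP.
  apply: (measurableT_comp (@measurable_powR R (-1)%R)).
  exact: measurable_funX.
- by move=> y; rewrite !mule_ge0// lee_fin powR_ge0.
move=> r r0; have mS := @measurable_sphere R n; split.
  rewrite /polar_density -[RHS]mule1 -(h1 r) -integral_sphere//.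
  rewrite -ge0_integralZl//; last exact: measurable_funTS.
  by apply: eq_integral => x; rewrite inE => xS; rewrite FE.
have mvr : measurable_fun setT (fun x => (v (scalet r x))%:E).
  apply/measurable_EFinP.
  exact: (measurableT_comp mv (@measurable_scalet1 R n r)).
have mhv : measurable_fun setT (fun x => h (r, x) * (v (scalet r x))%:E).
  exact: emeasurable_funM.
have hv0 x : 0 <= h (r, x) * (v (scalet r x))%:E by rewrite mule_ge0// lee_fin ltW.
have -> : polar_density sigma (fun x => F x * (v x)%:E) r =
    g r * \int[sigma]_x (h (r, x) * (v (scalet r x))%:E).
  rewrite /polar_density -integral_sphere//.
  rewrite -ge0_integralZl//; last exact: measurable_funTS.
  by apply: eq_integral => x; rewrite inE => xS; rewrite muleAC FE// muleA.
by rewrite muleCA; apply: lee_wpmul2l; [exact: g0|exact: hV].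
Qed.

(** The polar formula applied to the indicator of the null set [N] shows that, for almost every [r],
    the directions [x] with [scalet r x] in [N] form a [sigma]-null set. At such [r] the two
    essential suprema agree. *)
Lemma radial_esssup_version (v : n.-tuple R -> \bar R) (v0 : n.-tuple R -> R)
    (N : set (n.-tuple R)) : measurable N -> borel_lebesgue n N = 0 ->
  (forall x, ~ N x -> v x = (v0 x)%:E) ->
  exists G : set R, [/\ measurable G, lebesgue_measure G = 0 &
    forall r, ~ G r -> (0 < r)%R -> radial_esssup sigma v r = V0 v0 r].
Proof.
move=> mN N0 vv0.
pose IN x := (\1_N x : R)%:E.
have mIN : measurable_fun setT IN by apply/measurable_EFinP; exact: measurable_indic.
have IN0 x : 0 <= IN x by rewrite lee_fin indicE.
have mD := measurable_polar_density mIN IN0.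
have : \int[lebesgue_measure]_(r in `]0%R, +oo[) `|polar_density sigma IN r| = 0.
  rewrite -N0 -(setIT N) -(integral_indic _ measurableT mN) surface.2//.
  apply: eq_integral => r; rewrite inE/= in_itv/= andbT => r0.
  by rewrite gee0_abs//; exact: polar_density_ge0.
move=> /(ae_eq_integral_abs lebesgue_measure (measurable_itv _) mD)[G [mG G0 NG]].
exists G; split => // r nGr r0; apply: eq_ess_sup.
have mNr : measurable (scalet r @^-1` N).
  by rewrite -[X in measurable X]setTI; exact: measurable_scalet1.
exists (scalet r @^-1` N); split => //; last first.
  by move=> x /= xr; apply: contrapT => /vv0.
have : polar_density sigma IN r = 0.
  apply: contrapT => nz; apply: nGr; apply: NG => /= rz; apply: nz.
  by apply: rz; rewrite in_itv/= r0.
rewrite /polar_density integral_sphere; last 2 first.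
- apply: emeasurable_funM => //.
  exact: (measurableT_comp mIN (@measurable_scalet1 R n r)).
- by move=> x; rewrite mule_ge0// lee_fin exprn_ge0// ltW.
rewrite ge0_integralZr//; last 2 first.
- exact: (measurableT_comp mIN (@measurable_scalet1 R n r)).
- by rewrite lee_fin exprn_ge0// ltW.
rewrite (_ : \int[sigma]_x _ = sigma (scalet r @^-1` N)).
  by move=> /eqP; rewrite mule_eq0 => /orP[/eqP//|]; rewrite eqe gt_eqF// exprn_gt0.
transitivity (\int[sigma]_x (\1_(scalet r @^-1` N) x : R)%:E); first by [].
by rewrite integral_indic// setIT.
Qed.

End radial_reduction.

(** * Measurable primitives and Borel representatives of weights *)

Section transfer.
Context {R : realType}.

(** Tonelli for the zero extension of [G] times the indicator of the region [r < t]. *)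
Lemma measurable_primitive (G : R -> \bar R) :
  measurable_fun (`]0%R, +oo[%classic : set R) G ->
  (forall r, (0 < r)%R -> 0 <= G r) ->
  measurable_fun (setT : set R)
    (fun t => \int[lebesgue_measure]_(r in `]0%R, t[) G r).
Proof.
move=> mG G0; pose G' := G \_ (`]0%R, +oo[%classic : set R).
have mG' : measurable_fun (setT : set R) G'.
  exact/(measurable_restrictT _ (measurable_itv _)).
have G'0 r : 0 <= G' r.
  by rewrite /G' patchE; case: ifPn => //; rewrite inE/= in_itv/= andbT; exact: G0.
pose below := [set p : measurableTypeR R * measurableTypeR R | (p.2 < p.1 :> R)%R].
have mbelow : measurable below.
  have mlt := @measurable_fun_ltr _ (measurableTypeR R * measurableTypeR R)%type
    R setT snd fst measurable_snd measurable_fst.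
  by have := mlt measurableT [set true] I; rewrite setTI.
pose h (p : measurableTypeR R * measurableTypeR R) := G' p.2 * (\1_below p : R)%:E.
have mh : measurable_fun setT h.
  apply: emeasurable_funM; first exact: (measurableT_comp mG' measurable_snd).
  by apply/measurable_EFinP; exact: measurable_indic.
have h0 p : 0 <= h p by rewrite mule_ge0// lee_fin indicE.
have := measurable_fun_fubini_tonelli_F (m2 := @lebesgue_measure R) _ mh h0.
congr (measurable_fun _ _); apply/funext => t.
rewrite /fubini_F [RHS]integral_mkcond; apply: eq_integral => r _.
rewrite /h /G' /= !patchE indicE.
have -> : ((t, r) \in below) = (r < t)%R.
  by apply/idP/idP; rewrite inE.
rewrite !mem_setE !in_itv/= andbT.
by case: (0 < r)%R; case: (r < t)%R; rewrite /= ?mule1 ?mule0 ?mul0e.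
Qed.

(** A representative that is positive and finite everywhere frees the later estimates from
    almost-everywhere conditions on [v]. *)
Lemma weight_version n (v : n.-tuple R -> \bar R) : weight_Rn v ->
  exists (v0 : n.-tuple R -> R) (N : set (n.-tuple R)),
  [/\ measurable_fun setT v0, forall x, (0 < v0 x)%R, measurable N,
    borel_lebesgue n N = 0 & forall x, ~ N x -> v x = (v0 x)%:E].
Proof.
move=> [mv aev].
(* [v] may be negative on a null set, while a Borel version is taken of a nonnegative function. *)
have [||v1 [mv1 v10 [N1 [mN1 N10] vv1]]] := @space_version _ n v^\+.
- exact: measurable_funepos.
- by move=> x; exact: funepos_ge0.
have [N2 [mN2 N20 badN2]] := space_negligible aev.
pose P := [set x | v1 x \is a fin_num] `&` [set x | 0 < v1 x].
have mP : measurable P.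
  apply: measurableI; rewrite -[X in measurable X]setTI.
    exact: emeasurable_fin_num.
  exact: emeasurable_fun_o_infty.
(* Off [N1] and [N2] the value [v1 x] is positive and finite, so the default 1 is taken only inside
   the exceptional set. *)
exists (fun x => if x \in P then fine (v1 x) else 1%R), (N1 `|` N2); split.
- apply: measurable_fun_ifT => //.
    by apply: (measurable_fun_bool true); rewrite setTI preimage_mem_true.
  exact: measurableT_comp.
- move=> x; case: ifPn => //; rewrite inE => -[fx x0].
  by rewrite -lte_fin fineK.
- exact: measurableU.
- by apply/negligibleP; [exact: measurableU|apply: negligibleU; exact/negligibleP].
move=> x /not_orP[nN1 nN2].
have /andP[vx0 vxoo] : 0 < v x < +oo.
  by apply: contrapT => bad; apply: nN2; apply: badN2 => /= H; exact/bad/H.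
have v1x : v1 x = v x by rewrite -vv1// funeposE max_l// ltW.
have vfin : v x \is a fin_num by rewrite ge0_fin_numE// ltW.
by rewrite ifT ?v1x ?fineK// inE /P/= v1x.
Qed.

End transfer.

(** * Passing between functions on R^n and on the half-line *)

Section radial_transfer.
Context {R : realType} {n : nat}.
Variables (sigma : {measure set (n.-tuple R) -> \bar R}) (v : n.-tuple R -> \bar R).
Hypotheses (surface : is_surface_measure sigma) (wv : weight_Rn v).

Notation halfline := (`]0%R, +oo[%classic : set R).

Let sub_halfline t : (`]0%R, t[%classic : set R) `<=` halfline.
Proof. by move=> r /=; rewrite !in_itv/= => /andP[->]. Qed.

Let in_halfline r : halfline r -> (0 < r)%R.
Proof. by rewrite /= in_itv/= andbT. Qed.

Let measurable_on_halfline (f : R -> \bar R) : measurable_fun halfline f ->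
  @measurable_fun _ _ (LR R) _ halfline f.
Proof.
move=> mf _ Y mY; apply: sub_caratheodory.
exact: mf (measurable_itv _) _ mY.
Qed.

(** Moves both ball integrals from the Lebesgue to the Borel setting, where the polar formula is
    available. *)
Lemma eball_transfer (v0 : n.-tuple R -> R) (f f0 : n.-tuple R -> \bar R)
    (N M : set (n.-tuple R)) :
  measurable_fun setT v0 -> (forall x, (0 < v0 x)%R) ->
  measurable N -> borel_lebesgue n N = 0 -> (forall x, ~ N x -> v x = (v0 x)%:E) ->
  measurable_fun setT f0 -> (forall x, 0 <= f0 x) ->
  measurable M -> borel_lebesgue n M = 0 -> (forall x, ~ M x -> f x = f0 x) ->
  forall t, \int[lebesgueRn n]_(s in eball n t) f s =
    \int[lebesgue_measure]_(r in `]0%R, t[) polar_density sigma f0 r /\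
  \int[lebesgueRn n]_(s in eball n t) (f s * v s) =
    \int[lebesgue_measure]_(r in `]0%R, t[)
      polar_density sigma (fun x => f0 x * (v0 x)%:E) r.
Proof.
move=> mv0 v00 mN N0 vv0 mf0 f00 mM M0 ff0 t.
have mfv : measurable_fun setT (fun x => f0 x * (v0 x)%:E).
  by apply: emeasurable_funM => //; exact/measurable_EFinP.
have fv0 x : 0 <= f0 x * (v0 x)%:E by rewrite mule_ge0// lee_fin ltW.
have mB := @measurable_eball R n t.
split; rewrite -integral_eball//.
  apply: (proj2 (space_integral (G := M) mB _ _ _ _ _)) => //; first exact: measurable_funTS.
  by move=> x nM _; exact: ff0.
apply: (proj2 (space_integral (G := N `|` M) mB _ _ _ _ _)) => //.
- exact: measurable_funTS.
- exact: measurableU.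
- by apply/negligibleP; [exact: measurableU|apply: negligibleU; exact/negligibleP].
- by move=> x /not_orP[nN nM] _; rewrite ff0// vv0.
Qed.

Lemma halfline_transfer (v0 : n.-tuple R -> R) (g g0 : R -> \bar R)
    (N : set (n.-tuple R)) (M : set R) :
  measurable_fun setT v0 -> (forall x, (0 < v0 x)%R) ->
  measurable N -> borel_lebesgue n N = 0 -> (forall x, ~ N x -> v x = (v0 x)%:E) ->
  measurable_fun halfline g0 -> (forall r, (0 < r)%R -> 0 <= g0 r) ->
  measurable M -> lebesgue_measure M = 0 ->
  (forall r, ~ M r -> (0 < r)%R -> g r = g0 r) ->
  forall t, \int[lebR R]_(r in `]0%R, t[) g r =
    \int[lebesgue_measure]_(r in `]0%R, t[) g0 r /\
  \int[lebR R]_(r in `]0%R, t[) (g r * radial_esssup sigma v r) =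
    \int[lebesgue_measure]_(r in `]0%R, t[)
      (g0 r * radial_esssup sigma (EFin \o v0) r).
Proof.
move=> mv0 v00 mN N0 vv0 mg0 g00 mM M0 gg0 t.
(* Replacing [v] by [v0] affects the essential supremum only at radii in a null set, which is added
   to [M]. *)
have [G [mG G0 VG]] := radial_esssup_version surface mN N0 vv0.
have mI : measurable (`]0%R, t[%classic : set R) by exact: measurable_itv.
have mg0t : measurable_fun (`]0%R, t[%classic : set R) g0.
  exact: measurable_funS (@measurable_itv R _) (@sub_halfline t) mg0.
have pos r : (`]0%R, t[%classic : set R) r -> (0 < r)%R.
  by move=> /sub_halfline/in_halfline.
split.
  apply: (proj2 (line_integral (G := M) mI _ _ _ _ _)) => //; first by move=> r /pos/g00.
  by move=> r nM /pos; exact: gg0.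
apply: (proj2 (line_integral (G := M `|` G) mI _ _ _ _ _)).
- apply: emeasurable_funM => //; apply: measurable_funTS.
  exact: measurable_radial_esssup.
- by move=> r /pos r0; rewrite mule_ge0 ?g00//; exact: radial_esssup_ge0.
- exact: measurableU.
- by apply/negligibleP; [exact: measurableU|apply: negligibleU; exact/negligibleP].
- by move=> r /not_orP[nM nG] /pos r0; rewrite gg0// VG.
Qed.

Lemma measurable_halfline_primitive (h G : R -> \bar R) :
  measurable_fun halfline G -> (forall r, (0 < r)%R -> 0 <= G r) ->
  (forall t, h t = \int[lebesgue_measure]_(r in `]0%R, t[) G r) ->
  @measurable_fun _ _ (LR R) _ halfline h.
Proof.
move=> mG G0 hG; apply: measurable_on_halfline.
rewrite (_ : h = fun t => \int[lebesgue_measure]_(r in `]0%R, t[) G r); last exact/funext.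
by apply: measurable_funTS; exact: measurable_primitive.
Qed.

(** The witness is the polar density of a Borel version of [f]. The last two clauses give the
    measurability in [t] that [le_weighted_power_mean] asks for. *)
Lemma radialization (f : n.-tuple R -> \bar R) : @Mplus _ (LRn R n) R setT f ->
  exists g : R -> \bar R, @Mplus _ (LR R) R halfline g /\
  [/\ forall t, \int[lebR R]_(r in `]0%R, t[) g r =
        \int[lebesgueRn n]_(s in eball n t) f s,
      forall t, 0 <= \int[lebesgueRn n]_(s in eball n t) (f s * v s) <=
        \int[lebR R]_(r in `]0%R, t[) (g r * radial_esssup sigma v r),
      @measurable_fun _ _ (LR R) _ halfline
        (fun t => \int[lebesgueRn n]_(s in eball n t) (f s * v s)) &
      @measurable_fun _ _ (LR R) _ halfline
        (fun t => \int[lebR R]_(r in `]0%R, t[) (g r * radial_esssup sigma v r))].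
Proof.
move=> [mf f0]; have [v0 [N [mv0 v00 mN N0 vv0]]] := weight_version wv.
have [|f1 [mf1 f10 [M [mM M0] ff1]]] := space_version mf; first by move=> x; exact: f0.
have fT := eball_transfer mv0 v00 mN N0 vv0 mf1 f10 mM M0 ff1.
pose g := polar_density sigma f1.
have mg : measurable_fun halfline g by exact: measurable_polar_density.
have g0 r : (0 < r)%R -> 0 <= g r by move=> r0; exact: polar_density_ge0.
have gT t := halfline_transfer mv0 v00 mN N0 vv0 mg g0 measurable0 (measure0 _)
  (fun _ _ _ => erefl) t.
have mfv : measurable_fun setT (fun x => f1 x * (v0 x)%:E).
  by apply: emeasurable_funM => //; exact/measurable_EFinP.
have fv0 x : 0 <= f1 x * (v0 x)%:E by rewrite mule_ge0// lee_fin ltW.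
have mP := measurable_polar_density surface mfv fv0.
have P0 r : (0 < r)%R -> 0 <= polar_density sigma (fun x => f1 x * (v0 x)%:E) r.
  by move=> r0; exact: polar_density_ge0.
have mgV : measurable_fun halfline (fun r => g r * radial_esssup sigma (EFin \o v0) r).
  apply: emeasurable_funM => //; apply: measurable_funTS.
  exact: measurable_radial_esssup.
have gV0 r : (0 < r)%R -> 0 <= g r * radial_esssup sigma (EFin \o v0) r.
  by move=> r0; rewrite mule_ge0 ?g0//; exact: radial_esssup_ge0.
exists g; split.
  by split; [exact: measurable_on_halfline|move=> r /in_halfline; exact: g0].
split.
- by move=> t; rewrite (gT t).1 (fT t).1.
- move=> t; rewrite (gT t).2 (fT t).2; apply/andP; split.
    by apply: integral_ge0 => r /sub_halfline/in_halfline; exact: P0.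
  apply: ge0_le_integral => //.
  + by move=> r /sub_halfline/in_halfline; exact: P0.
  + exact: measurable_funS (@sub_halfline t) mP.
  + exact: measurable_funS (@sub_halfline t) mgV.
  + by move=> r /sub_halfline/in_halfline r0; exact: polar_densityM_le.
- by apply: measurable_halfline_primitive mP P0 _ => t; exact: (fT t).2.
- by apply: measurable_halfline_primitive mgV gV0 _ => t; exact: (gT t).2.
Qed.

Lemma deradialization (g : R -> \bar R) : @Mplus _ (LR R) R halfline g ->
  exists f : n.-tuple R -> \bar R, @Mplus _ (LRn R n) R setT f /\
  [/\ forall t, \int[lebesgueRn n]_(s in eball n t) f s =
        \int[lebR R]_(r in `]0%R, t[) g r,
      forall t, 0 <= \int[lebR R]_(r in `]0%R, t[) (g r * radial_esssup sigma v r) <=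
        2%:E * \int[lebesgueRn n]_(s in eball n t) (f s * v s),
      @measurable_fun _ _ (LR R) _ halfline
        (fun t => \int[lebR R]_(r in `]0%R, t[) (g r * radial_esssup sigma v r)) &
      @measurable_fun _ _ (LR R) _ halfline
        (fun t => \int[lebesgueRn n]_(s in eball n t) (f s * v s))].
Proof.
move=> [mg g0]; have [v0 [N [mv0 v00 mN N0 vv0]]] := weight_version wv.
(* [g] is controlled on the half-line only; its extension by zero is measurable and nonnegative on
   the whole line and so has a Borel version. *)
have mgr : @measurable_fun _ _ (LR R) _ setT (g \_ halfline).
  exact/(measurable_restrictT _ measurable_halfline).
have [|g1 [mg1 g10 [M [mM M0] gg1]]] := line_version mgr.
  by move=> r; rewrite patchE; case: ifPn => //; rewrite inE; exact: g0.
have gg1' r : ~ M r -> (0 < r)%R -> g r = g1 r.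
  by move=> nM r0; rewrite -gg1// patchE ifT// mem_setE in_itv/= r0.
have [f [mf f0 fP]] := concentrated_function surface mg1 g10 mv0 v00.
have fT := eball_transfer mv0 v00 mN N0 vv0 mf f0 measurable0 (measure0 _)
  (fun _ _ => erefl).
have gT t := halfline_transfer mv0 v00 mN N0 vv0 (measurable_funTS mg1)
  (fun r _ => g10 r) mM M0 gg1' t.
have mfv : measurable_fun setT (fun x => f x * (v0 x)%:E).
  by apply: emeasurable_funM => //; exact/measurable_EFinP.
have fv0 x : 0 <= f x * (v0 x)%:E by rewrite mule_ge0// lee_fin ltW.
have mP := measurable_polar_density surface mfv fv0.
have P0 r : (0 < r)%R -> 0 <= polar_density sigma (fun x => f x * (v0 x)%:E) r.
  by move=> r0; exact: polar_density_ge0.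
have mgV : measurable_fun halfline (fun r => g1 r * radial_esssup sigma (EFin \o v0) r).
  apply: measurable_funTS; apply: emeasurable_funM => //.
  exact: measurable_radial_esssup.
have gV0 r : (0 < r)%R -> 0 <= g1 r * radial_esssup sigma (EFin \o v0) r.
  by move=> r0; rewrite mule_ge0//; exact: radial_esssup_ge0.
exists f; split.
  split; last by move=> x _; exact: f0.
  move=> _ Y mY.
  have := @measurable_space_id R n measurableT _ (mf measurableT Y mY).
  by rewrite setTI; apply.
split.
- move=> t; rewrite (gT t).1 (fT t).1; apply: eq_integral => r.
  by rewrite inE => /sub_halfline/in_halfline/fP[].
- move=> t; rewrite (gT t).2 (fT t).2; apply/andP; split.
    by apply: integral_ge0 => r /sub_halfline/in_halfline; exact: gV0.
  rewrite -ge0_integralZl_EFin//; last 2 first.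
  + by move=> r /sub_halfline/in_halfline; exact: P0.
  + exact: measurable_funS (@sub_halfline t) mP.
  apply: ge0_le_integral => //.
  + by move=> r /sub_halfline/in_halfline; exact: gV0.
  + exact: measurable_funS (@sub_halfline t) mgV.
  + apply: emeasurable_funM => //; exact: measurable_funS (@sub_halfline t) mP.
  + by move=> r /sub_halfline/in_halfline/fP[].
- by apply: measurable_halfline_primitive mgV gV0 _ => t; exact: (gT t).2.
- by apply: measurable_halfline_primitive mP P0 _ => t; exact: (fT t).2.
Qed.

End radial_transfer.

(** * The two implications and the best constants *)

Lemma halfline_of_ball_inequality (R : realType) (n : nat) (q theta : R)
    (sigma : {measure set (n.-tuple R) -> \bar R}) (u w : R -> \bar R)
    (v : n.-tuple R -> \bar R) (C : R) : (0 < q)%R ->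
  is_surface_measure sigma -> weight_halfline u -> weight_Rn v -> (0 <= C)%R ->
  ball_inequality q theta u w v C ->
  halfline_inequality q theta u w (radial_esssup sigma v) (2 * C).
Proof.
move=> q0 surface wu wv C0 ineq g Mg.
have [f [Mf [fg gfv mgv mfv]]] := deradialization surface wv Mg.
have -> : \int[lebR R]_(t in `]0%R, +oo[)
    ((\int[lebR R]_(s in `]0%R, t[) g s) `^ theta * w t) =
  \int[lebR R]_(t in `]0%R, +oo[)
    ((\int[lebesgueRn n]_(s in eball n t) f s) `^ theta * w t).
  by apply: eq_integral => t _; rewrite fg.
have m2fv : @measurable_fun _ _ (LR R) _ `]0%R, +oo[%classic
    (fun t => 2%:E * \int[lebesgueRn n]_(s in eball n t) (f s * v s)).
  exact: emeasurable_funM.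
apply: le_trans (le_weighted_power_mean measurable_halfline q0 wu mgv m2fv _) _.
  by move=> t _; exact: gfv.
have fv0 t : 0 <= \int[lebesgueRn n]_(s in eball n t) (f s * v s).
  have /andP[a b] := gfv t.
  by have := le_trans a b; rewrite pmule_rge0.
(* The factor 2 passes unchanged through the power [q] and the root [q^-1]. *)
rewrite (weighted_power_meanZ measurable_halfline q0 wu)//.
by rewrite EFinM -muleA; apply: lee_wpmul2l => //; exact: ineq.
Qed.

Lemma ball_of_halfline_inequality (R : realType) (n : nat) (q theta : R)
    (sigma : {measure set (n.-tuple R) -> \bar R}) (u w : R -> \bar R)
    (v : n.-tuple R -> \bar R) (C : R) : (0 < q)%R ->
  is_surface_measure sigma -> weight_halfline u -> weight_Rn v ->
  halfline_inequality q theta u w (radial_esssup sigma v) C ->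
  ball_inequality q theta u w v C.
Proof.
move=> q0 surface wu wv ineq f Mf.
have [g [Mg [gf fgv mfv mgv]]] := radialization surface wv Mf.
have -> : \int[lebR R]_(t in `]0%R, +oo[)
    ((\int[lebesgueRn n]_(s in eball n t) f s) `^ theta * w t) =
  \int[lebR R]_(t in `]0%R, +oo[)
    ((\int[lebR R]_(s in `]0%R, t[) g s) `^ theta * w t).
  by apply: eq_integral => t _; rewrite gf.
apply: le_trans (le_weighted_power_mean measurable_halfline q0 wu mfv mgv _) _.
  by move=> t _; exact: fgv.
exact: ineq.
Qed.

(** After division by [a] it suffices to bound each admissible constant of [P] from below, which
    also settles the case where there is none and the right side is infinite. *)
Lemma best_constant_le (R : realType) (P Q : R -> Prop) (a : R) : (0 < a)%R ->
  (forall C, (0 <= C)%R -> P C -> Q (a * C)%R) ->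
  best_constant Q <= a%:E * best_constant P.
Proof.
move=> a0 PQ; rewrite -lee_pdivrMl//; apply: le_ereal_inf_tmp => _ [C [C0 PC] <-].
rewrite lee_pdivrMl// -EFinM; apply: ereal_inf_lbound.
by exists (a * C)%R => //; split; [rewrite mulr_ge0// ltW|exact: PQ].
Qed.

Unset Implicit Arguments.

Theorem theorem2p2 (R : realType) (n : nat) (q theta : R) :
  (1 <= n)%N -> (0 < q)%R -> (0 < theta)%R ->
  exists lambda : R, (0 < lambda)%R /\
  forall (sigma : {measure set (n.-tuple R) -> \bar R})
    (u w : R -> \bar R) (v : n.-tuple R -> \bar R),
  is_surface_measure sigma ->
  weight_halfline u -> weight_halfline w -> weight_Rn v ->
  let ineq_i := ball_inequality q theta u w v in
  let ineq_ii := halfline_inequality q theta u w (radial_esssup sigma v) in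
  ((exists C : R, (0 <= C)%R /\ ineq_i C) <->
   (exists C' : R, (0 <= C')%R /\ ineq_ii C')) /\
  (lambda^-1)%:E * best_constant ineq_ii <= best_constant ineq_i /\
  best_constant ineq_i <= lambda%:E * best_constant ineq_ii.
Proof.
(* The constant 2 is the loss in [concentrated_density]. *)
move=> _ q0 _; exists 2%R; split=> // sigma u w v surface wu _ wv ineq_i ineq_ii.
have i_ii C : (0 <= C)%R -> ineq_i C -> ineq_ii (2 * C)%R.
  exact: halfline_of_ball_inequality.
have ii_i C : ineq_ii C -> ineq_i C by exact: ball_of_halfline_inequality.
split; [split => -[C [C0 HC]]|split].
- by exists (2 * C)%R; split; [rewrite mulr_ge0|exact: i_ii].
- by exists C; split; [|exact: ii_i].
- by rewrite -lee_pdivlMl// invrK; exact: best_constant_le.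
(* This bound holds with factor 1; nonnegativity of the best constant allows enlarging it to 2. *)
apply: (@le_trans _ _ (best_constant ineq_ii)).
  by rewrite -[leRHS]mul1e; apply: best_constant_le => // C _; rewrite mul1r; exact: ii_i.
apply: lee_pemull; last by rewrite lee_fin ler1n.
by apply: le_ereal_inf_tmp => _ [C [C0 _] <-]; rewrite lee_fin.
Qed.
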